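(* Let $H$ be a finite-dimensional Hopf algebra over a field $k$, let $0\neq t\in H$ be a left integral, and let $A$ be a unital $k$-algebra with a symmetric partial action of $H$ such that $h\cdot 1_A$ lies in the center of $A$ for every $h\in H$. Let $A^{\underline{H}}$ be the subalgebra of partial invariants and $\underline{A\# H}$ the partial smash product. View $A$ as an $\underline{A\# H}$–$A^{\underline{H}}$ bimodule via $(\underline{a\# h})\rhd b=a(h\cdot b)$ and right multiplication by $A^{\underline{H}}$, and as an $A^{\underline{H}}$–$\underline{A\# H}$ bimodule via left multiplication by $A^{\underline{H}}$ and $b\lhd(\underline{a\# h})=\sum \alpha(h_{(2)})\,S^{-1}(h_{(1)})\cdot(ba)$. Define $$[\cdot,\cdot]:A\otimes_{A^{\underline{H}}}A\to \underline{A\# H},\quad [a,b]=(\underline{a\# 1_H})(\underline{1_A\# t})(\underline{b\# 1_H}),$$ $$\langle\cdot,\cdot\rangle:A\otimes_{\underline{A\# H}}A\to A^{\underline{H}},\quad \langle a,b\rangle=t\cdot(ab).$$ Then $(\underline{A\# H},\,A^{\underline{H}},\,{}_{\underline{A\# H}}A_{A^{\underline{H}}},\,{}_{A^{\underline{H}}}A_{\underline{A\# H}},\,[\cdot,\cdot],\,\langle\cdot,\cdot\rangle)$ is a Morita context.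
   Context: Sweedler notation $\Delta(h)=\sum h_{(1)}\otimes h_{(2)}$ is used; $S$ is the antipode (bijective since $H$ is finite-dimensional) and $\epsilon$ the counit. A partial action of a Hopf algebra $H$ on a unital algebra $A$ is a linear map $H\otimes A\to A$, $h\otimes a\mapsto h\cdot a$, with (i) $h\cdot(ab)=\sum(h_{(1)}\cdot a)(h_{(2)}\cdot b)$; (ii) $1_H\cdot a=a$; (iii) $h\cdot(g\cdot a)=\sum(h_{(1)}\cdot 1_A)((h_{(2)}g)\cdot a)$. It is symmetric if also (iv) $h\cdot(g\cdot a)=\sum((h_{(1)}g)\cdot a)(h_{(2)}\cdot 1_A)$. Partial invariants: $A^{\underline{H}}=\{a\in A: h\cdot a=a(h\cdot 1_A)\ \forall h\in H\}$, a subalgebra of $A$. Partial smash product: $A\otimes H$ is an associative algebra under $(a\otimes h)(b\otimes g)=\sum a(h_{(1)}\cdot b)\otimes h_{(2)}g$, and $\underline{A\# H}=(A\otimes H)(1_A\otimes 1_H)$, i.e. the span of the elements $\underline{a\# h}=\sum a(h_{(1)}\cdot 1_A)\otimes h_{(2)}$; its unit is $1_A\otimes 1_H$. A left integral is $t\in H$ with $ht=\epsilon(h)t$ for all $h$. The space of left integrals is one-dimensional and $\alpha:H\to k$ is the algebra morphism defined by $th=\alpha(h)t$ for $h\in H$. A Morita context is a six-tuple $(R,S,M,N,[\cdot,\cdot],\langle\cdot,\cdot\rangle)$ with $R,S$ rings, $M$ an $R$–$S$ bimodule, $N$ an $S$–$R$ bimodule, $[\cdot,\cdot]:M\otimes_S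 N\to R$ and $\langle\cdot,\cdot\rangle:N\otimes_R M\to S$ bimodule morphisms such that $[m,n]m'=m\langle n,m'\rangle$ and $\langle n,m\rangle n'=n[m,n']$ for all $m,m'\in M$, $n,n'\in N$. In particular, the assertion includes that the stated maps are well defined on the balanced tensor products. *)

(* Defs.v *)
From HB Require Import structures.
From mathcomp Require Import all_boot all_order all_algebra all_field.
From mathcomp Require Import boolp classical_sets freeg.

Set Implicit Arguments.
Unset Strict Implicit.
Unset Printing Implicit Defensive.

Import GRing.Theory.
Local Open Scope ring_scope.
Local Open Scope quotient_scope.

(** [tensor r l] is M \ox_S N for the right action [r] of [S] on [M] and the
    left action [l] of [S] on [N]: the free abelian group on M * N modulo the
    usual relations.  Several modules below share the carrier [A], so actions
    are explicit arguments rather than canonical structures. *)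

Section Tensor.
Variables (S : Type) (M N : zmodType) (r : M -> S -> M) (l : S -> N -> N).

Inductive tensor_rel : {freeg M * N} -> Prop :=
| TensorRelDl m m' n :
    tensor_rel (<< (m + m', n) >> - << (m, n) >> - << (m', n) >>)
| TensorRelDr m n n' :
    tensor_rel (<< (m, n + n') >> - << (m, n) >> - << (m, n') >>)
| TensorRelS m s n :
    tensor_rel (<< (r m s, n) >> - << (m, l s n) >>).

Definition tensor_ker : {pred {freeg M * N}} :=
  fun x => `[< forall P : pred {freeg M * N}, zmod_closed P ->
        (forall y, tensor_rel y -> y \in P) -> x \in P >].

Fact tensor_ker_closed : zmod_closed tensor_ker.
Proof.
split=> [|x y /asboolP xK /asboolP yK]; apply/asboolP => P Pc relP.
  by case: Pc.
by case: (Pc) => _; apply; [apply: xK | apply: yK].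
Qed.

HB.instance Definition _ :=
  GRing.isZmodClosed.Build {freeg M * N} tensor_ker tensor_ker_closed.

Definition tensor : Type := Quotient.quot tensor_ker.
HB.instance Definition _ := GRing.Zmodule.on tensor.

Definition tens (m : M) (n : N) : tensor :=
  \pi_(Quotient.quot tensor_ker) << (m, n) >>.

Lemma tensor_piE (x : {freeg M * N}) :
  tensor_rel x -> \pi_(Quotient.quot tensor_ker) x = 0.
Proof.
move=> xr; rewrite -[RHS](raddf0 \pi_(Quotient.quot tensor_ker)).
apply/eqP; rewrite -Quotient.idealrBE subr0.
by apply/asboolP => P _; apply.
Qed.

Lemma tensDl n : {morph tens^~ n : m m' / m + m'}.
Proof.
move=> m m'; have /eqP := tensor_piE (TensorRelDl m m' n).
by rewrite !raddfB /= subr_eq0 subr_eq [X in _ == X]addrC => /eqP.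
Qed.

Lemma tensDr m : {morph tens m : n n' / n + n'}.
Proof.
move=> n n'; have /eqP := tensor_piE (TensorRelDr m n n').
by rewrite !raddfB /= subr_eq0 subr_eq [X in _ == X]addrC => /eqP.
Qed.

Lemma tens_balanced m s n : tens (r m s) n = tens m (l s n).
Proof.
have /eqP := tensor_piE (TensorRelS m s n).
by rewrite raddfB /= subr_eq0 => /eqP.
Qed.

Lemma tens0l n : tens 0 n = 0.
Proof. by apply: (addrI (tens 0 n)); rewrite -tensDl !addr0. Qed.

Lemma tens0r m : tens m 0 = 0.
Proof. by apply: (addrI (tens m 0)); rewrite -tensDr !addr0. Qed.

Lemma tensNl m n : tens (- m) n = - tens m n.
Proof. by apply: (addrI (tens m n)); rewrite -tensDl !subrr tens0l. Qed.

Lemma tensor_ind (P : tensor -> Prop) :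
  (forall m n, P (tens m n)) -> (forall x y, P x -> P y -> P (x + y)) ->
  forall x, P x.
Proof.
move=> Pt PD; have P0 : P 0 by rewrite -(tens0l 0).
have PMn m n j : P (tens m n *+ j).
  by elim: j => [|j IHj]; rewrite ?mulr0n // mulrS; apply: PD.
apply: quotP => /= x _; elim/freeg_ind_dom0: x => [|j [m n] x _ _ Px].
  by rewrite raddf0.
rewrite raddfD; apply: PD => //=.
have -> : << j *g (m, n) >> = << (m, n) >> *~ j :> {freeg M * N}.
  by rewrite freegU_mulz intz.
rewrite raddfMz -/(tens m n); case: j => j; first exact: PMn.
by rewrite NegzE mulrNz -mulNrz -tensNl; apply: PMn.
Qed.

(** [tlift F] is the map out of the tensor product induced by [F]; it is
    computed on a representative, so it is meaningful when [F] is balanced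
    (lemma [tlift_tens]). *)
Section Lift.
Variable V : zmodType.

Definition tlift (F : M -> N -> V) (x : tensor) : V :=
  fglift ((fun p => F p.1 p.2) : M * N -> zmodule V) (repr x).

Definition balanced (F : M -> N -> V) : Prop :=
  [/\ forall n, {morph F^~ n : m m' / m + m'},
      forall m, {morph F m : n n' / n + n'}
    & forall m s n, F (r m s) n = F m (l s n)].

Implicit Type F : M -> N -> V.

Lemma tlift_pi F x : balanced F ->
  tlift F (\pi_(Quotient.quot tensor_ker) x) =
  fglift ((fun p => F p.1 p.2) : M * N -> zmodule V) x.
Proof.
move=> [FDl FDr FS]; set f : M * N -> zmodule V := fun p => _.
have fB : {morph fglift f : x y / x - y} by exact: lift_is_additive.
have fU m n : fglift f << (m, n) >> = F m n by rewrite liftU scale1r.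
apply/eqP; rewrite /tlift -/f -subr_eq0 -fB.
set z := _ - x; have : z \in tensor_ker.
  by rewrite Quotient.idealrBE reprK.
move=> /asboolP/(_ (fun y => fglift f y == 0)); apply.
  by split=> [|y z' /eqP y0 /eqP z0]; rewrite unfold_in ?fB ?y0 ?z0 ?subr0 //;
    rewrite -(subrr 0) fB subrr.
move=> _ [m m' n|m n n'|m s n]; rewrite unfold_in !fB !fU.
- by rewrite FDl addrAC addrK subrr.
- by rewrite FDr addrAC addrK subrr.
- by rewrite FS subrr.
Qed.

Lemma tlift_tens F m n : balanced F -> tlift F (tens m n) = F m n.
Proof. by move=> Fb; rewrite /tens tlift_pi // liftU scale1r. Qed.

Lemma tliftD F : balanced F -> {morph tlift F : x y / x + y}.
Proof.
move=> Fb x y; rewrite -[x]reprK -[y]reprK -raddfD !tlift_pi //.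
set f : M * N -> zmodule V := fun p => _.
have fB : {morph fglift f : x y / x - y} by exact: lift_is_additive.
have f0 : fglift f 0 = 0 by rewrite -(subrr 0) fB subrr.
have fN z : fglift f (- z) = - fglift f z by rewrite -sub0r fB f0 sub0r.
by rewrite -[repr y in LHS]opprK fB fN opprK.
Qed.

Lemma tlift_sumE F x :
  tlift F x = \sum_(z <- repr (repr x)) F z.2.1 z.2.2 *~ z.1.
Proof. by rewrite /tlift -[repr x in LHS]reprK pi_fglift. Qed.

Lemma tlift_funD F G x :
  tlift (fun m n => F m n + G m n) x = tlift F x + tlift G x.
Proof.
by rewrite !tlift_sumE -big_split; apply: eq_bigr => z _; rewrite /= mulrzDl.
Qed.

Lemma eq_tlift F G x : (forall m n, F m n = G m n) -> tlift F x = tlift G x.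
Proof. by move=> eFG; rewrite !tlift_sumE; apply: eq_bigr => z _; rewrite eFG. Qed.

End Lift.

Lemma raddf_tlift (V W : zmodType) (f : V -> W) (F : M -> N -> V) x :
  {morph f : u v / u + v} -> f (tlift F x) = tlift (fun m n => f (F m n)) x.
Proof.
move=> fD; have f0 : f 0 = 0 by apply: (addrI (f 0)); rewrite -fD !addr0.
have fN u : f (- u) = - f u by apply: (addrI (f u)); rewrite -fD !subrr.
have fMn u n : f (u *+ n) = f u *+ n.
  by elim: n => [|n IHn]; rewrite ?mulr0n // !mulrS fD IHn.
rewrite !tlift_sumE (big_morph f fD f0); apply: eq_bigr => z _.
by case: (z.1) => j; rewrite /intmul ?fN fMn.
Qed.

Lemma tensor_ext (V : zmodType) (f g : tensor -> V) :
  {morph f : x y / x + y} -> {morph g : x y / x + y} ->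
  (forall m n, f (tens m n) = g (tens m n)) -> f =1 g.
Proof. by move=> fD gD fg; elim/tensor_ind => [|x y IHx IHy] //; rewrite fD gD IHx IHy. Qed.

End Tensor.

Lemma exchange_tlift (S S' : Type) (M N M' N' V : zmodType)
    (r : M -> S -> M) (l : S -> N -> N) (r' : M' -> S' -> M')
    (l' : S' -> N' -> N') (F : M -> N -> M' -> N' -> V)
    (x : tensor r l) (y : tensor r' l') :
  tlift (fun m n => tlift (F m n) y) x =
  tlift (fun m' n' => tlift (fun m n => F m n m' n') x) y.
Proof.
rewrite !tlift_sumE.
under eq_bigr do rewrite tlift_sumE mulrz_suml.
rewrite exchange_big; apply: eq_bigr => z _ /=.
rewrite tlift_sumE mulrz_suml; apply: eq_bigr => w _.
by rewrite mulrzAC.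
Qed.

Section KTensor.
Variables (k : fieldType) (M N : lmodType k).

Definition ktensor : Type :=
  tensor (fun (m : M) (c : k) => c *: m) (fun (c : k) (n : N) => c *: n).

HB.instance Definition _ := GRing.Zmodule.on ktensor.

Definition ktens (m : M) (n : N) : ktensor := tens _ _ m n.
Definition klift (V : zmodType) (F : M -> N -> V) (x : ktensor) : V := tlift F x.

Definition ktensor_scale (c : k) : ktensor -> ktensor :=
  klift (fun m n => ktens (c *: m) n).

Lemma ktensDl n : {morph ktens^~ n : m m' / m + m'}.
Proof. exact: tensDl. Qed.

Lemma ktensDr m : {morph ktens m : n n' / n + n'}.
Proof. exact: tensDr. Qed.

Lemma ktens_balanced m c n : ktens (c *: m) n = ktens m (c *: n).
Proof. exact: tens_balanced. Qed.

Lemma ktensor_ext (V : zmodType) (f g : ktensor -> V) :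
  {morph f : x y / x + y} -> {morph g : x y / x + y} ->
  (forall m n, f (ktens m n) = g (ktens m n)) -> f =1 g.
Proof. exact: tensor_ext. Qed.

Definition kbalanced (V : zmodType) (F : M -> N -> V) :=
  balanced (fun (m : M) (c : k) => c *: m) (fun (c : k) (n : N) => c *: n) F.

Lemma klift_tens (V : zmodType) (F : M -> N -> V) m n :
  kbalanced F -> klift F (ktens m n) = F m n.
Proof. exact: tlift_tens. Qed.

Lemma kliftD (V : zmodType) (F : M -> N -> V) :
  kbalanced F -> {morph klift F : x y / x + y}.
Proof. exact: tliftD. Qed.

Lemma klift_funD (V : zmodType) (F G : M -> N -> V) x :
  klift (fun m n => F m n + G m n) x = klift F x + klift G x.
Proof. exact: tlift_funD. Qed.

Lemma eq_klift (V : zmodType) (F G : M -> N -> V) x :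
  (forall m n, F m n = G m n) -> klift F x = klift G x.
Proof. exact: eq_tlift. Qed.

Lemma raddf_klift (V W : zmodType) (f : V -> W) (F : M -> N -> V) x :
  {morph f : u v / u + v} -> f (klift F x) = klift (fun m n => f (F m n)) x.
Proof. exact: raddf_tlift. Qed.

Fact ktensor_scale_balanced c : kbalanced (fun m n => ktens (c *: m) n).
Proof.
split=> [n m m'|m n n'|m d n]; first by rewrite scalerDr ktensDl.
  exact: ktensDr.
by rewrite scalerA mulrC -scalerA ktens_balanced.
Qed.

Fact ktensor_scaleD c : {morph ktensor_scale c : x y / x + y}.
Proof. exact/kliftD/ktensor_scale_balanced. Qed.

Fact ktensor_scaleE c m n : ktensor_scale c (ktens m n) = ktens (c *: m) n.
Proof. exact/klift_tens/ktensor_scale_balanced. Qed.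

Fact ktensor_scaleA a b x :
  ktensor_scale a (ktensor_scale b x) = ktensor_scale (a * b) x.
Proof.
move: x; apply: ktensor_ext => [x y|x y|m n]; rewrite ?ktensor_scaleD //.
by rewrite !ktensor_scaleE scalerA.
Qed.

Fact ktensor_scale1 : left_id 1 ktensor_scale.
Proof.
apply: ktensor_ext => [x y|x y|m n] //; first by rewrite ktensor_scaleD.
by rewrite ktensor_scaleE scale1r.
Qed.

Fact ktensor_scaleDr : right_distributive ktensor_scale +%R.
Proof. by move=> c; apply: ktensor_scaleD. Qed.

Fact ktensor_scaleDl x : {morph ktensor_scale^~ x : a b / a + b}.
Proof.
move=> a b; rewrite -klift_funD; apply: eq_klift => m n.
by rewrite scalerDl ktensDl.
Qed.

HB.instance Definition _ := GRing.Zmodule_isLmodule.Build k ktensor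
  ktensor_scaleA ktensor_scale1 ktensor_scaleDr ktensor_scaleDl.

Lemma ktensZl c m n : ktens (c *: m) n = c *: ktens m n.
Proof. by rewrite -ktensor_scaleE. Qed.

Lemma ktensZr c m n : ktens m (c *: n) = c *: ktens m n.
Proof. by rewrite -ktens_balanced ktensZl. Qed.

Lemma linear_addE (U V : lmodType k) (f : U -> V) :
  linear f -> {morph f : x y / x + y}.
Proof. by move=> fl x y; rewrite -[x]scale1r fl !scale1r. Qed.

Lemma linear_scaleE (U V : lmodType k) (f : U -> V) c x :
  linear f -> f (c *: x) = c *: f x.
Proof.
move=> fl; have f0 : f 0 = 0.
  by apply: (addrI (f 0)); rewrite -(linear_addE fl) !addr0.
by rewrite -[c *: x]addr0 fl f0 addr0.
Qed.

Section Linear.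
Variables (V W : lmodType k).
Implicit Type F : M -> N -> V.

Lemma bilinear_kbalanced F :
  (forall n, linear (F^~ n)) -> (forall m, linear (F m)) -> kbalanced F.
Proof.
move=> Fl Fr; split=> [n|m|m c n]; [exact: linear_addE|exact: linear_addE|].
by rewrite (linear_scaleE _ _ (Fl n)) (linear_scaleE _ _ (Fr m)).
Qed.

Lemma klift_linear F (g : W -> ktensor) :
  (forall n, linear (F^~ n)) -> (forall m, linear (F m)) ->
  linear g -> linear (fun u => klift F (g u)).
Proof.
move=> Fl Fr gl c u v; have Fb := bilinear_kbalanced Fl Fr.
rewrite gl kliftD //; congr (_ + _); move: (g u).
apply: ktensor_ext => [x y|x y|m n].
- by rewrite scalerDr kliftD.
- by rewrite kliftD // scalerDr.
- by rewrite -ktensZl !klift_tens // (linear_scaleE _ _ (Fl n)).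
Qed.

Lemma klift_fun_linear (F : W -> M -> N -> V) x :
  (forall m n, linear (fun u => F u m n)) -> linear (fun u => klift (F u) x).
Proof.
move=> Fl c u v; rewrite (raddf_klift (f := *:%R c)) -?klift_funD.
  by apply: eq_klift => m n; apply: Fl.
by move=> a b; rewrite scalerDr.
Qed.

End Linear.

End KTensor.

Notation "M \ox N" := (ktensor M N) (at level 40, left associativity) : type_scope.
Notation "m \ox n" := (ktens m n) (at level 40, left associativity) : ring_scope.

HB.mixin Record Falgebra_isHopf (k : fieldType) H of Falgebra k H := {
  comul : {linear H -> (H \ox H)%type};
  counit : {scalar H};
  antipode : {linear H -> H};
  comulA : forall h : H,
    klift (fun h1 h2 => klift (fun h11 h12 => h11 \ox (h12 \ox h2)) (comul h1))
      (comul h) =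
    klift (fun h1 h2 => klift (fun h21 h22 => h1 \ox (h21 \ox h22)) (comul h2))
      (comul h);
  counitl : forall h : H, klift (fun h1 h2 => counit h1 *: h2) (comul h) = h;
  counitr : forall h : H, klift (fun h1 h2 => counit h2 *: h1) (comul h) = h;
  comul1 : comul 1 = 1 \ox 1;
  comulM : forall h g : H, comul (h * g) =
    klift (fun h1 h2 => klift (fun g1 g2 => (h1 * g1) \ox (h2 * g2)) (comul g))
      (comul h);
  counit1 : counit 1 = 1;
  counitM : {morph counit : h g / h * g};
  antipodel : forall h : H,
    klift (fun h1 h2 => antipode h1 * h2) (comul h) = counit h *: 1;
  antipoder : forall h : H,
    klift (fun h1 h2 => h1 * antipode h2) (comul h) = counit h *: 1
}.

#[short(type="hopfType")]
HB.structure Definition Hopf (k : fieldType) :=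
  {H of Falgebra k H & Falgebra_isHopf k H}.

(** [\sw_(h1, h2 <- h) F] is Sweedler's sum of F(h_(1), h_(2)), for F bilinear. *)
Notation "\sw_ ( h1 , h2 <- h ) F" := (klift (fun h1 h2 => F) (comul h))
  (at level 41, F at level 41, h1 name, h2 name,
   format "'[' \sw_ ( h1 ,  h2  <-  h ) '/  '  F ']'") : ring_scope.

Section LinearExpr.
Variables (k : fieldType) (A : algType k) (U V W : lmodType k).

Lemma lin_id : linear (fun u : U => u). Proof. by []. Qed.

Lemma lin_comp (f : {linear V -> W}) (g : U -> V) :
  linear g -> linear (fun u => f (g u)).
Proof. by move=> gl c u v; rewrite gl linearP. Qed.

Lemma lin_mull (a : A) (g : U -> A) : linear g -> linear (fun u => a * g u).
Proof. by move=> gl c u v; rewrite gl mulrDr scalerAr. Qed.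

Lemma lin_mulr (a : A) (g : U -> A) : linear g -> linear (fun u => g u * a).
Proof. by move=> gl c u v; rewrite gl mulrDl scalerAl. Qed.

Lemma lin_tensl (n : W) (g : U -> V) : linear g -> linear (fun u => g u \ox n).
Proof. by move=> gl c u v; rewrite gl ktensDl ktensZl. Qed.

Lemma lin_tensr (m : V) (g : U -> W) : linear g -> linear (fun u => m \ox g u).
Proof. by move=> gl c u v; rewrite gl ktensDr ktensZr. Qed.

Lemma lin_bill (f : {bilinear U -> V -> W}) (X : lmodType k) (g : X -> U) v :
  linear g -> linear (fun x => f (g x) v).
Proof. by move=> gl c x y; rewrite gl linearPl. Qed.

Lemma lin_bilr (f : {bilinear U -> V -> W}) (X : lmodType k) (g : X -> V) u :
  linear g -> linear (fun x => f u (g x)).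
Proof. by move=> gl c x y; rewrite gl linearPr. Qed.

End LinearExpr.

Ltac lin_step := first
  [ exact: lin_id | apply: lin_tensl | apply: lin_tensr | apply: lin_mull
  | apply: lin_mulr | apply: lin_bill | apply: lin_bilr
  | apply: klift_linear => [?|?|] | apply: klift_fun_linear => ? ?
  | apply: lin_comp ].
Ltac lin := do 1? (repeat lin_step).

Lemma exchange_klift (k : fieldType) (M N M' N' : lmodType k) (V : zmodType)
    (F : M -> N -> M' -> N' -> V) (x : M \ox N) (y : M' \ox N') :
  klift (fun m n => klift (F m n) y) x =
  klift (fun m' n' => klift (fun m n => F m n m' n') x) y.
Proof. exact: exchange_tlift. Qed.

Section HopfTheory.
Variables (k : fieldType) (H : hopfType k).

Section Sweedler.
Variable V : lmodType k.

Lemma sw_coassoc (F : H -> H -> H -> V) h :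
  (forall x y, linear (fun z => F z x y)) ->
  (forall x y, linear (fun z => F x z y)) ->
  (forall x y, linear (fun z => F x y z)) ->
  \sw_(h1, h2 <- h) \sw_(h11, h12 <- h1) F h11 h12 h2 =
  \sw_(h1, h2 <- h) \sw_(h21, h22 <- h2) F h1 h21 h22.
Proof.
move=> F1 F2 F3; pose L a := klift (F a).
have Lb a : kbalanced (F a) by apply: bilinear_kbalanced.
have Bl n : linear (L^~ n) by apply: klift_fun_linear.
have Br m : linear (L m) by apply: klift_linear.
have Gb := bilinear_kbalanced Bl Br.
have := congr1 (klift L) (comulA h).
rewrite !(raddf_klift _ _ (kliftD Gb)) => E.
transitivity (klift (fun h1 h2 => klift L
    (klift (fun h11 h12 => h11 \ox (h12 \ox h2)) (comul h1))) (comul h)).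
  apply: eq_klift => x y; rewrite (raddf_klift _ _ (kliftD Gb)).
  by apply: eq_klift => u v; rewrite klift_tens // /L klift_tens.
rewrite E; apply: eq_klift => x y; rewrite (raddf_klift _ _ (kliftD Gb)).
by apply: eq_klift => u v; rewrite klift_tens // /L klift_tens.
Qed.

Lemma sw_mul (F : H -> H -> V) h g :
  (forall y, linear (F^~ y)) -> (forall x, linear (F x)) ->
  \sw_(x, y <- h * g) F x y =
  \sw_(h1, h2 <- h) \sw_(g1, g2 <- g) F (h1 * g1) (h2 * g2).
Proof.
move=> Fl Fr; have Fb := bilinear_kbalanced Fl Fr.
rewrite comulM (raddf_klift _ _ (kliftD Fb)); apply: eq_klift => x y.
rewrite (raddf_klift _ _ (kliftD Fb)); apply: eq_klift => u v.
by rewrite klift_tens.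
Qed.

Lemma sw_1 (F : H -> H -> V) :
  (forall y, linear (F^~ y)) -> (forall x, linear (F x)) ->
  \sw_(x, y <- 1) F x y = F 1 1.
Proof.
by move=> Fl Fr; rewrite comul1 klift_tens //; apply: bilinear_kbalanced.
Qed.

End Sweedler.

(** The antipode of a finite-dimensional Hopf algebra is bijective, and
    [lfun] inversion is then the usual inverse. *)
Definition antipode_inv : H -> H := ((linfun (antipode : H -> H))^-1)%VF.

Definition left_integral (t : H) : Prop := forall h : H, h * t = counit h *: t.

(** The scalar c with t h = c t; it exists and is unique when t is a nonzero
    left integral. *)
Definition modular_char (t h : H) : k := xget 0 [set c : k | t * h = c *: t].

End HopfTheory.

Section PartialAction.
Variables (k : fieldType) (H : hopfType k) (A : algType k).

Record partial_action := PartialAction {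
  pact :> {bilinear H -> A -> A};
  pactM : forall h a b, pact h (a * b) = \sw_(h1, h2 <- h) (pact h1 a * pact h2 b);
  pact1 : forall a, pact 1 a = a;
  pact_comp : forall h g a,
    pact h (pact g a) = \sw_(h1, h2 <- h) (pact h1 1 * pact (h2 * g) a)
}.

Definition symmetric_action (pa : partial_action) : Prop :=
  forall h g a, pa h (pa g a) = \sw_(h1, h2 <- h) (pa (h1 * g) a * pa h2 1).

Variable pa : partial_action.

Definition pinv : {pred A} := fun a => `[< forall h, pa h a = a * pa h 1 >].

Lemma pinvP a : reflect (forall h, pa h a = a * pa h 1) (a \in pinv).
Proof. exact: asboolP. Qed.

Fact pact_balanced a b :
  kbalanced (fun h1 h2 => pa h1 a * pa h2 b).
Proof.
split=> [n m m'|m n n'|m c n].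
- by rewrite linearDl mulrDl.
- by rewrite linearDl mulrDr.
- by rewrite !linearZl_LR -scalerAl scalerAr.
Qed.

Fact pinv_closed : GRing.subalg_closed pinv.
Proof.
split=> [|c a b /pinvP aI /pinvP bI|a b /pinvP aI /pinvP bI]; apply/pinvP => h.
- by rewrite mul1r.
- by rewrite linearPr aI bI mulrDl scalerAl.
- rewrite pactM.
  under eq_klift do rewrite aI -mulrA.
  rewrite -(raddf_klift (f := *%R a)); last by move=> u v; rewrite mulrDr.
  by rewrite -pactM mul1r bI mulrA.
Qed.

HB.instance Definition _ := GRing.isSubalgClosed.Build k A pinv pinv_closed.

Record pinvariants := PInvariant { pinv_val :> A; _ : pinv_val \in pinv }.
HB.instance Definition _ := [isSub for pinv_val].
HB.instance Definition _ := [Choice of pinvariants by <:].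
HB.instance Definition _ := [SubChoice_isSubAlgebra of pinvariants by <:].

Definition pinv_lact (c : pinvariants) (b : A) : A := pinv_val c * b.
Definition pinv_ract (b : A) (c : pinvariants) : A := b * pinv_val c.

Definition smash_mul (x y : A \ox H) : A \ox H :=
  klift (fun a h => klift (fun b g =>
    \sw_(h1, h2 <- h) ((a * pa h1 b) \ox (h2 * g))) y) x.

Fact smash_mull y : linear (smash_mul^~ y).
Proof. by rewrite /smash_mul; lin. Qed.

Fact smash_mulr x : linear (smash_mul x).
Proof. by rewrite /smash_mul; lin. Qed.

Fact smash_mulE a h b g : smash_mul (a \ox h) (b \ox g) =
  \sw_(h1, h2 <- h) ((a * pa h1 b) \ox (h2 * g)).
Proof.
rewrite /smash_mul !klift_tens //; apply: bilinear_kbalanced => ?; lin.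
Qed.

Fact pact_mul_comp h b g c : pa h (b * pa g c) =
  \sw_(h1, h2 <- h) (pa h1 b * pa (h2 * g) c).
Proof.
rewrite pactM.
under eq_klift => h1 h2.
  rewrite pact_comp (raddf_klift (f := *%R (pa h1 b))); last first.
    by move=> u v; rewrite mulrDr.
  under eq_klift do rewrite mulrA.
  over.
rewrite -(sw_coassoc (F := fun x y z => pa x b * pa y 1 * pa (z * g) c));
  try by move=> ? ?; lin.
apply: eq_klift => h1 h2; rewrite -[in RHS](mulr1 b) pactM.
rewrite [RHS](raddf_klift (f := fun u => u * pa (h2 * g) c)) //.
by move=> u v; rewrite mulrDl.
Qed.

Fact smash_mulA : associative smash_mul.
Proof.
have sl := smash_mull; have sr := smash_mulr.
move=> x y z; move: x; apply: ktensor_ext => [x x'|x x'|a h].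
- by rewrite (linear_addE (sl _)).
- by rewrite !(linear_addE (sl _)).
move: y; apply: ktensor_ext => [y y'|y y'|b g].
- by rewrite (linear_addE (sl _)) (linear_addE (sr _)).
- by rewrite (linear_addE (sr _)) (linear_addE (sl _)).
move: z; apply: ktensor_ext => [z z'|z z'|c f].
- by rewrite !(linear_addE (sr _)).
- by rewrite (linear_addE (sr _)).
rewrite !smash_mulE (raddf_klift _ _ (linear_addE (sr _))).
rewrite (raddf_klift (f := smash_mul^~ _) _ _ (linear_addE (sl _))).
under eq_klift do rewrite smash_mulE.
rewrite exchange_klift.
under [RHS]eq_klift => h1 h2.
  rewrite smash_mulE sw_mul; [|by move=> ?; lin|by move=> ?; lin].
  over.
rewrite -(sw_coassoc (F := fun x y z =>
  \sw_(g1, g2 <- g) ((a * pa x b * pa (y * g1) c) \ox (z * g2 * f))));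
  try by move=> ? ?; lin.
apply: eq_klift => h1 h2; rewrite [RHS]exchange_klift.
apply: eq_klift => g1 g2; rewrite pact_mul_comp.
rewrite (raddf_klift (f := fun u => (a * u) \ox (h2 * (g2 * f)))).
  by apply: eq_klift => u v; rewrite !mulrA.
by move=> u v; rewrite mulrDr ktensDl.
Qed.

Definition smash_pred : {pred (A \ox H)%type} :=
  fun x => `[< exists y, x = smash_mul y (1 \ox 1) >].

Lemma smash_predP x : reflect (exists y, x = smash_mul y (1 \ox 1)) (x \in smash_pred).
Proof. exact: asboolP. Qed.

Fact smash_mul1x x : smash_mul (1 \ox 1) x = x.
Proof.
move: x; apply: ktensor_ext => [x y|//|b g].
  by rewrite (linear_addE (smash_mulr _)).
rewrite smash_mulE sw_1; [|by move=> ?; lin|by move=> ?; lin].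
by rewrite pact1 !mul1r.
Qed.

Fact smash_mulx1 x : x \in smash_pred -> smash_mul x (1 \ox 1) = x.
Proof. by case/smash_predP => y ->; rewrite -smash_mulA smash_mul1x. Qed.

Fact smash_closed : submod_closed smash_pred.
Proof.
split=> [|c x y /smash_mulx1 <- /smash_mulx1 <-]; apply/smash_predP.
  by exists 0; rewrite -{2}(subrr (0 : A \ox H)) -scaleN1r (linear_addE (smash_mull _))
    (linear_scaleE _ _ (smash_mull _)) scaleN1r subrr.
by exists (c *: x + y); rewrite smash_mull.
Qed.

HB.instance Definition _ :=
  GRing.isSubmodClosed.Build k (A \ox H)%type smash_pred smash_closed.

(** The subspace (A \ox H)(1 \ox 1): 1 \ox 1 is a two-sided unit there, but only
    a left unit in A \ox H. *)
Record smash := Smash { smash_val :> (A \ox H)%type; _ : smash_val \in smash_pred }.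
HB.instance Definition _ := [isSub for smash_val].
HB.instance Definition _ := [Choice of smash by <:].
HB.instance Definition _ := [SubChoice_isSubLmodule of smash by <:].

Fact smash_mul_in (x y : smash) : smash_mul x y \in smash_pred.
Proof.
by case: y => y /= /smash_mulx1 <-; apply/smash_predP; rewrite smash_mulA; eexists.
Qed.

Fact smash_one_in : 1 \ox 1 \in smash_pred.
Proof. by apply/smash_predP; exists (1 \ox 1); rewrite smash_mul1x. Qed.

Let smash_one := Smash smash_one_in.
Let smash_rmul (x y : smash) := Smash (smash_mul_in x y).

Fact smash_rmulA : associative smash_rmul.
Proof. by move=> x y z; apply/val_inj/smash_mulA. Qed.

Fact smash_rmul1x : left_id smash_one smash_rmul.
Proof. by move=> x; apply/val_inj/smash_mul1x. Qed.

Fact smash_rmulx1 : right_id smash_one smash_rmul.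
Proof. by move=> x; apply/val_inj/smash_mulx1/valP. Qed.

Fact smash_rmulDl : left_distributive smash_rmul +%R.
Proof.
by move=> x y z; apply/val_inj/(linear_addE (smash_mull _)).
Qed.

Fact smash_rmulDr : right_distributive smash_rmul +%R.
Proof.
by move=> x y z; apply/val_inj/(linear_addE (smash_mulr _)).
Qed.

HB.instance Definition _ := GRing.Zmodule_isPzRing.Build smash
  smash_rmulA smash_rmul1x smash_rmulx1 smash_rmulDl smash_rmulDr.

Fact smash_elt_in a h :
  \sw_(h1, h2 <- h) ((a * pa h1 1) \ox h2) \in smash_pred.
Proof.
apply/smash_predP; exists (a \ox h); rewrite smash_mulE.
by apply: eq_klift => h1 h2; rewrite mulr1.
Qed.

Definition smash_elt (a : A) (h : H) : smash := Smash (smash_elt_in a h).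

End PartialAction.

Arguments pinv_lact {k H A} pa c b.
Arguments pinv_ract {k H A} pa b c.

Record left_module (R : pzRingType) (M : zmodType) (act : R -> M -> M) : Prop := {
  lactDl : forall m, {morph act^~ m : r s / r + s};
  lactDr : forall r, {morph act r : m n / m + n};
  lact1 : forall m, act 1 m = m;
  lactA : forall r s m, act (r * s) m = act r (act s m)
}.

Record right_module (S : pzRingType) (M : zmodType) (act : M -> S -> M) : Prop := {
  ractDl : forall s, {morph act^~ s : m n / m + n};
  ractDr : forall m, {morph act m : r s / r + s};
  ract1 : forall m, act m 1 = m;
  ractA : forall m r s, act m (r * s) = act (act m r) s
}.

Record bimodule (R S : pzRingType) (M : zmodType)
    (lact : R -> M -> M) (ract : M -> S -> M) : Prop := {
  bimod_left : left_module lact;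
  bimod_right : right_module ract;
  bimodA : forall r m s, ract (lact r m) s = lact r (ract m s)
}.

Record bimodule_morphism (R S : pzRingType) (M N : zmodType)
    (lM : R -> M -> M) (rM : M -> S -> M) (lN : R -> N -> N) (rN : N -> S -> N)
    (f : M -> N) : Prop := {
  bimod_morphD : {morph f : x y / x + y};
  bimod_morphl : forall r x, f (lM r x) = lN r (f x);
  bimod_morphr : forall x s, f (rM x s) = rN (f x) s
}.

(** The R-R bimodule structure of M \ox_S N, for M an R-S bimodule and N an
    S-R bimodule. *)
Definition tensor_lact (R S : pzRingType) (M N : zmodType) (lM : R -> M -> M)
    (rM : M -> S -> M) (lN : S -> N -> N) (r : R) : tensor rM lN -> tensor rM lN :=
  tlift (fun m n => tens rM lN (lM r m) n).

Definition tensor_ract (R S : pzRingType) (M N : zmodType) (rM : M -> S -> M)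
    (lN : S -> N -> N) (rN : N -> R -> N) (x : tensor rM lN) (r : R) :
    tensor rM lN :=
  tlift (fun m n => tens rM lN m (rN n r)) x.

Arguments tensor_lact {R S M N} lM rM lN r x.
Arguments tensor_ract {R S M N} rM lN rN x r.

Record morita_context (R S : pzRingType) (M N : zmodType)
    (lM : R -> M -> M) (rM : M -> S -> M) (lN : S -> N -> N) (rN : N -> R -> N)
    (sq : tensor rM lN -> R) (ang : tensor rN lM -> S) : Prop := {
  morita_bimodM : bimodule lM rM;
  morita_bimodN : bimodule lN rN;
  morita_sq : bimodule_morphism
    (tensor_lact lM rM lN) (tensor_ract rM lN rN) *%R *%R sq;
  morita_ang : bimodule_morphism
    (tensor_lact lN rN lM) (tensor_ract rN lM rM) *%R *%R ang;
  morita_sqA : forall m n m',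
    lM (sq (tens rM lN m n)) m' = rM m (ang (tens rN lM n m'));
  morita_angA : forall n m n',
    lN (ang (tens rN lM n m)) n' = rN n (sq (tens rM lN m n'))
}.

Arguments morita_context {R S M N} lM rM lN rN sq ang.

(* Main.v *)
Require Import Defs.
From HB Require Import structures.
From mathcomp Require Import all_boot all_order all_algebra all_field.
From mathcomp Require classical_sets.

Set Implicit Arguments.
Unset Strict Implicit.
Unset Printing Implicit Defensive.
Import GRing.Theory.
Local Open Scope ring_scope.

(** For a nonzero left integral t one has S(h) t1 (x) t2 = t1 (x) h t2, so
    {f(t1) t2} is a left ideal of H; choosing f with f(t) = 1, it contains
    f(t1) S(t2) t3 = 1, which makes S injective, hence bijective.  Then
    {t1 f(t2)} is a left ideal too and contains S^-1(t2) t1 f(t3) = 1.  So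
    t1 lam(t2) = 1 for some functional lam, which yields the uniqueness of left
    integrals and, with the identity
      alpha(h2) t1 S^-1(h1) (x) t2 = t1 (x) t2 h,
    also S^-1(t1) alpha(t2) = t.  The last two formulas are what the
    compatibility of the right action of the smash product with the two pairings
    amounts to; the partial action enters through h.(b (g.c)) = (h1.b)(h2 g.c)
    and its symmetric counterpart h.((g.a) b) = (h1 g.a)(h2.b). *)

(** * Linearity side conditions and linear maps applied to Sweedler sums *)

Section Linearity.
Variables (k : fieldType) (U V W : lmodType k).

Lemma lin_app (f : V -> W) (g : U -> V) :
  linear f -> linear g -> linear (fun u => f (g u)).
Proof. by move=> fl gl c u v; rewrite gl fl. Qed.

Lemma lin_scalel (f : {scalar V}) (g : U -> V) (w : W) :
  linear g -> linear (fun u => f (g u) *: w).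
Proof. by move=> gl c u v; rewrite gl linearP scalerDl scalerA. Qed.

Lemma lin_scaler (c : k) (g : U -> V) : linear g -> linear (fun u => c *: g u).
Proof. by move=> gl d u v; rewrite gl scalerDr !scalerA mulrC. Qed.

Lemma lin_sum (I : Type) (r : seq I) (f : I -> U -> V) :
  (forall i, linear (f i)) -> linear (fun u => \sum_(i <- r) f i u).
Proof.
move=> fl c u v; rewrite scaler_sumr -big_split.
by apply: eq_bigr => i _; rewrite fl.
Qed.

Lemma linear_at0 (f : V -> W) : linear f -> f 0 = 0.
Proof. by move=> fl; rewrite -(scale0r 0) linear_scaleE // scale0r. Qed.

End Linearity.

(** Every Sweedler manipulation below asks for linearity in each variable. The tactic [linear]
    proves this from the shape of the expression and from linearity hypotheses in the context. *)
Ltac linear_step := first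
  [ lin_step | apply: lin_scalel | apply: lin_scaler | apply: lin_sum => ?
  | match goal with Fl : forall _, linear _ |- _ => apply: (lin_app (Fl _)) end
  | match goal with Fl : linear _ |- _ => apply: (lin_app Fl) end ].
Ltac linear := intros; repeat linear_step.

Section KLift.
Variables (k : fieldType) (M N : lmodType k).

Lemma linear_klift (V W : lmodType k) (f : V -> W) (F : M -> N -> V) x :
  linear f -> f (klift F x) = klift (fun m n => f (F m n)) x.
Proof. by move=> fl; apply/raddf_klift/linear_addE. Qed.

Lemma scaler_klift (V : lmodType k) c (F : M -> N -> V) x :
  c *: klift F x = klift (fun m n => c *: F m n) x.
Proof. by apply: (linear_klift (f := fun v => c *: v)); linear. Qed.

Lemma mulr_klift (A : algType k) a (F : M -> N -> A) x :
  a * klift F x = klift (fun m n => a * F m n) x.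
Proof. by apply: (linear_klift (f := fun v => a * v)); linear. Qed.

Lemma klift_mulr (A : algType k) a (F : M -> N -> A) x :
  klift F x * a = klift (fun m n => F m n * a) x.
Proof. by apply: (linear_klift (f := fun v => v * a)); linear. Qed.

Lemma klift0 (V : lmodType k) (x : (M \ox N)%type) :
  klift (fun _ _ => 0 : V) x = 0.
Proof.
rewrite -[RHS](scale0r (klift (fun _ _ => 0) x)) scaler_klift.
by apply: eq_klift => a b; rewrite scaler0.
Qed.

Lemma klift_sum (V : lmodType k) n (F : 'I_n -> M -> N -> V)
    (x : (M \ox N)%type) :
  klift (fun a b => \sum_i F i a b) x = \sum_i klift (F i) x.
Proof.
elim: n F => [|n IHn] F.
  rewrite big_ord0 -[RHS](klift0 V x).
  by apply: eq_klift => a b; rewrite big_ord0.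
rewrite big_ord_recl -IHn -klift_funD.
by apply: eq_klift => a b; rewrite big_ord_recl.
Qed.

End KLift.

(** * Cancellation in Sweedler sums; the antipode reverses products and coproducts *)

Section Hopf.
Variables (k : fieldType) (H : hopfType k).

Section Counit.
Variable V : lmodType k.

Lemma sw_counitl (f : H -> V) h : linear f ->
  \sw_(h1, h2 <- h) (counit h1 *: f h2) = f h.
Proof.
move=> fl; rewrite -[in RHS](counitl h) (linear_klift _ _ fl).
by apply: eq_klift => x y; rewrite linear_scaleE.
Qed.

Lemma sw_counitr (f : H -> V) h : linear f ->
  \sw_(h1, h2 <- h) (counit h2 *: f h1) = f h.
Proof.
move=> fl; rewrite -[in RHS](counitr h) (linear_klift _ _ fl).
by apply: eq_klift => x y; rewrite linear_scaleE.
Qed.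

Variables (q : H -> H -> H).
Hypothesis qE : forall h, \sw_(h1, h2 <- h) q h1 h2 = counit h *: 1.

(** Here [q] stands for any of S(h1) h2, h1 S(h2), S^-1(h2) h1 and h2 S^-1(h1), the last two once S
    is known to be bijective. *)
Lemma sw_cancell (F : H -> H -> V) h :
  (forall y, linear (F^~ y)) -> (forall x, linear (F x)) ->
  \sw_(h1, h2 <- h) \sw_(x, y <- h1) F (q x y) h2 = F 1 h.
Proof.
move=> Fl Fr; rewrite -[RHS](sw_counitl _ (Fr 1)); apply: eq_klift => x y.
by rewrite -(linear_klift _ _ (Fl y)) qE (linear_scaleE _ _ (Fl y)).
Qed.

Lemma sw_cancelr (F : H -> H -> V) h :
  (forall y, linear (F^~ y)) -> (forall x, linear (F x)) ->
  \sw_(h1, h2 <- h) \sw_(x, y <- h2) F h1 (q x y) = F h 1.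
Proof.
move=> Fl Fr; rewrite -[RHS](sw_counitr _ (Fl 1)); apply: eq_klift => x y.
by rewrite -(linear_klift _ _ (Fr x)) qE (linear_scaleE _ _ (Fr x)).
Qed.

End Counit.

Notation S := (antipode : H -> H).

Lemma antipode1 : S 1 = 1.
Proof.
have := antipodel (1 : H); rewrite sw_1; try by linear.
by rewrite mulr1 counit1 scale1r.
Qed.

Lemma counit_antipode (h : H) : counit (S h) = counit h.
Proof.
have := congr1 counit (antipodel h).
rewrite linearZ /= counit1 mulr1 => <-.
rewrite (raddf_klift _ _ (f := counit)) => [|u v]; last by rewrite linearD.
rewrite -[in LHS](counitr h) [S _]linear_klift; last by linear.
rewrite (raddf_klift _ _ (f := counit)) => [|u v]; last by rewrite linearD.
by apply: eq_klift => x y; rewrite !linearZ /= counitM mulrC.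
Qed.

(** Both sides are convolution inverses of multiplication: each equals S(h1 g1) h2 g2 S(g3) S(h3),
    cancelled from the right or from the left. *)
Lemma antipodeM (h g : H) : S (h * g) = S g * S h.
Proof.
transitivity (\sw_(h1, h2 <- h) \sw_(a, b <- h2) \sw_(g1, g2 <- g)
  \sw_(c, d <- g2) (S (h1 * g1) * (a * (c * S d) * S b))).
  rewrite -[LHS]mulr1.
  rewrite -(sw_cancelr (@antipoder _ _) (F := fun x z => S (x * g) * z));
    try by linear.
  apply: eq_klift => x y; apply: eq_klift => a b.
  rewrite (sw_cancelr (@antipoder _ _)
    (F := fun g1 z => S (x * g1) * (a * z * S b))) ?mulr1 //; by linear.
transitivity (\sw_(h1, h2 <- h) \sw_(a, b <- h1) \sw_(g1, g2 <- g)
  \sw_(c, d <- g1) (S (a * c) * (b * d) * (S g2 * S h2))).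
  rewrite [RHS]sw_coassoc; try by linear.
  apply: eq_klift => x y; apply: eq_klift => a b.
  rewrite [RHS]sw_coassoc; try by linear.
  by apply: eq_klift => z w; apply: eq_klift => c d; rewrite !mulrA.
transitivity (\sw_(h1, h2 <- h) \sw_(g1, g2 <- g)
  (counit h1 *: (counit g1 *: (S g2 * S h2)))).
  apply: eq_klift => x y; rewrite exchange_klift; apply: eq_klift => z w.
  rewrite -(sw_mul (F := fun a b => S a * b * (S w * S y))); try by linear.
  by rewrite -klift_mulr antipodel counitM -scalerAl mul1r scalerA.
rewrite -(sw_counitl (f := fun y => S g * S y)); last by linear.
apply: eq_klift => x y; rewrite -scaler_klift.
by rewrite (sw_counitl (f := fun z => S z * S y)); last by linear.
Qed.

(** Both sides are convolution inverses of the coproduct. Inserting h2 S(h3) in the first factor,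
    and then a similar product in the second, multiplies the coproduct of S(h1) by h2 S(h5) and h3
    S(h4). *)
Lemma sw_antipode (V : lmodType k) (F : H -> H -> V) h :
  (forall y, linear (F^~ y)) -> (forall x, linear (F x)) ->
  \sw_(x, y <- S h) F x y = \sw_(h1, h2 <- h) F (S h2) (S h1).
Proof.
move=> Fl Fr.
transitivity (\sw_(h1, h2 <- h) \sw_(a, b <- h2)
     \sw_(x, y <- S h1) F (x * (a * S b)) y).
  transitivity (\sw_(x, y <- S h) F (x * 1) y).
    by apply: eq_klift => x y; rewrite mulr1.
  by rewrite -(sw_cancelr (@antipoder _ _) (F := fun h z => \sw_(x, y <- S h)
     F (x * z) y)); try by linear.
transitivity (\sw_(h1, h2 <- h) \sw_(a, b <- h2) \sw_(a1, a2 <- a)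
  \sw_(b1, b2 <- b) \sw_(x, y <- S h1) F (x * (a1 * S b2)) (y * (a2 * S b1))).
  apply: eq_klift => h1 h2; rewrite [RHS]sw_coassoc; try by linear.
  apply: eq_klift => a r.
  rewrite -(sw_coassoc (F := fun a2 b1 b2 =>
    \sw_(x, y <- S h1) F (x * (a * S b2)) (y * (a2 * S b1)))); try by linear.
  rewrite (sw_cancell (@antipoder _ _) (F := fun z b2 =>
    \sw_(x, y <- S h1) F (x * (a * S b2)) (y * z))); try by linear.
  by apply: eq_klift => x y; rewrite mulr1.
rewrite -(sw_coassoc (F := fun h1 a b => \sw_(a1, a2 <- a) \sw_(b1, b2 <- b)
  \sw_(x, y <- S h1) F (x * (a1 * S b2)) (y * (a2 * S b1)))); try by linear.
rewrite -[RHS](sw_counitl (f := fun h => \sw_(h1, h2 <- h) F (S h2) (S h1)));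
  last by linear.
apply: eq_klift => u b.
(* [P] absorbs the trailing antipodes; what remains is the coproduct of S(h1) h2, which collapses to
   the counit. *)
pose P x y := \sw_(b1, b2 <- b) F (x * S b2) (y * S b1).
have Pl y : linear (P^~ y) by rewrite /P; linear.
have Pr x : linear (P x) by rewrite /P; linear.
transitivity (\sw_(h1, a <- u) \sw_(x, y <- S h1 * a) P x y).
  apply: eq_klift => h1 a; rewrite sw_mul // [RHS]exchange_klift.
  apply: eq_klift => a1 a2; rewrite exchange_klift; apply: eq_klift => x y.
  by apply: eq_klift => b1 b2; rewrite !mulrA.
rewrite -(linear_klift (f := fun z => \sw_(x, y <- z) P x y)); last by linear.
rewrite antipodel (linear_scaleE (f := fun z => \sw_(x, y <- z) P x y));
  last by linear.
by rewrite sw_1 // /P; congr (_ *: _); apply: eq_klift => x y; rewrite !mul1r.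
Qed.

End Hopf.

(** An [lfun] inverse is linear even before S is known to be bijective; the instance lets [linear]
    handle it. *)
Fact antipode_inv_linear (k : fieldType) (H : hopfType k) :
  linear (@antipode_inv k H).
Proof. exact: linearP. Qed.

HB.instance Definition _ (k : fieldType) (H : hopfType k) :=
  GRing.isLinear.Build k H H *:%R (@antipode_inv k H)
    (@antipode_inv_linear k H).

(** * Left integrals, bijectivity of the antipode and uniqueness of integrals *)

Section Integral.
Variables (k : fieldType) (H : hopfType k) (t : H).
Hypotheses (t_neq0 : t != 0) (t_int : left_integral t).
Notation S := (antipode : H -> H).
Notation Si := (@antipode_inv k H).

(** As h t is a multiple of t by the counit, the left side is S(h1) h2 t1 in the first slot and h3
    t2 in the second, and S(h1) h2 cancels. *)
Lemma integral_shift (V : lmodType k) (F : H -> H -> V) h :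
  (forall y, linear (F^~ y)) -> (forall x, linear (F x)) ->
  \sw_(t1, t2 <- t) F (S h * t1) t2 = \sw_(t1, t2 <- t) F t1 (h * t2).
Proof.
move=> Fl Fr.
transitivity (\sw_(h1, h2 <- h) \sw_(a, b <- h2) \sw_(t1, t2 <- t)
  F (S h1 * (a * t1)) (b * t2)).
  rewrite -[LHS](sw_counitr (f := fun h => \sw_(t1, t2 <- t) F (S h * t1) t2));
    last by linear.
  apply: eq_klift => h1 h2.
  rewrite -(sw_mul (F := fun x y => F (S h1 * x) y)) ?t_int; try by linear.
  by rewrite (linear_scaleE (f := fun z => \sw_(x, y <- z) F (S h1 * x) y));
    last by linear.
rewrite -(sw_coassoc (F := fun h1 a b => \sw_(t1, t2 <- t)
  F (S h1 * (a * t1)) (b * t2))); try by linear.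
transitivity (\sw_(u, b <- h) \sw_(h1, a <- u) \sw_(t1, t2 <- t)
  F (S h1 * a * t1) (b * t2)).
  apply: eq_klift => u b; apply: eq_klift => h1 a.
  by apply: eq_klift => t1 t2; rewrite mulrA.
rewrite (sw_cancell (@antipodel _ _) (F := fun z b => \sw_(t1, t2 <- t)
  F (z * t1) (b * t2))); try by linear.
by apply: eq_klift => t1 t2; rewrite mul1r.
Qed.

Notation e := (vbasis (fullv : {vspace H})).

(** [integral_shift] moves only elements independent of the components of t. Expanding a component
    in a basis replaces it by fixed vectors that can be moved. *)
Lemma sum_coord (V : lmodType k) (f : H -> V) h : linear f ->
  f h = \sum_i (coord e i h *: f e`_i).
Proof.
move=> fl; rewrite {1}(coord_vbasis (memvf h)).
rewrite (big_morph f (linear_addE fl) (linear_at0 fl)).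
by apply: eq_bigr => i _; rewrite linear_scaleE.
Qed.

(** Bridges linearity into the module [k^o] and scalar forms with values in [k]. *)
Definition scalar_of (f : H -> k) (fl : linear (f : H -> k^o)) : {scalar H} :=
  HB.pack f (GRing.isLinear.Build k H k *%R f fl).

Lemma exists_scalar_one : exists f : {scalar H}, f t = 1.
Proof.
have [i ti] : exists i, coord e i t != 0.
  apply/existsP; apply: contraR t_neq0 => /existsPn t0.
  rewrite (coord_vbasis (memvf t)) big1 // => i _.
  by have /negPn/eqP -> := t0 i; rewrite scale0r.
pose c := (coord e i t)^-1.
have fl : linear (fun h => c * coord e i h : k^o).
  by move=> d u v; rewrite linearP mulrDr mulrCA.
by exists (scalar_of fl); rewrite /= /c mulVf.
Qed.

Lemma antipode_eq0 g : S g = 0 -> g = 0.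
Proof.
(* Expand t2 in g = f(t1) g S(t2) t3: moving g S(e_i) across the tensor turns it
   into S(g S(e_i)) = S^2(e_i) S(g) = 0. *)
move=> Sg0; have [f ft1] := exists_scalar_one.
have -> : g = \sw_(a, b <- t) \sw_(a1, a2 <- a) (f a1 *: (g * (S a2 * b))).
  rewrite sw_coassoc; try by linear.
  rewrite (sw_cancelr (@antipodel _ _) (F := fun a z => f a *: (g * z)));
    try by linear.
  by rewrite ft1 scale1r mulr1.
transitivity (\sum_i \sw_(a, b <- t) \sw_(a1, a2 <- a)
  (f a1 *: (coord e i a2 *: (g * S e`_i * b)))).
  rewrite -klift_sum; apply: eq_klift => a b.
  rewrite -klift_sum; apply: eq_klift => a1 a2.
  rewrite -scaler_sumr (sum_coord (f := fun z => g * (S z * b)) a2);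
    last by linear.
  by under eq_bigr do rewrite mulrA.
apply: big1 => i _.
rewrite -(integral_shift (F := fun a b => \sw_(a1, a2 <- a)
  (f a1 *: (coord e i a2 *: b)))); try by linear.
rewrite antipodeM Sg0 mulr0 -[RHS](klift0 _ (comul t)).
apply: eq_klift => a b; rewrite mul0r.
apply: (linear_at0 (f := fun z => \sw_(a1, a2 <- z)
  (f a1 *: (coord e i a2 *: b)))); linear.
Qed.

Lemma antipode_lker0 : lker (linfun S) == 0%VS.
Proof.
apply/lker0P => x y; rewrite !lfunE /= => /eqP.
by rewrite -subr_eq0 -linearB /= => /eqP/antipode_eq0/subr0_eq.
Qed.

Lemma antipodeK : cancel S Si.
Proof.
by move=> x; rewrite -[S x](lfunE antipode) [LHS]lker0_lfunK ?antipode_lker0.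
Qed.

Lemma antipode_invK : cancel Si S.
Proof.
by move=> x; rewrite -[S _](lfunE antipode) [LHS]lker0_lfunVK ?antipode_lker0.
Qed.

Notation S_inj := (can_inj antipodeK).

Lemma antipode_inv1 : Si 1 = 1.
Proof. by rewrite -{1}(antipode1 H) antipodeK. Qed.

Lemma antipode_invM h g : Si (h * g) = Si g * Si h.
Proof. by apply: S_inj; rewrite antipodeM !antipode_invK. Qed.

(** The injective map S reverses products, so applying it gives the antipode axiom S(h1) h2. *)
Lemma antipode_invl h : \sw_(h1, h2 <- h) (Si h2 * h1) = counit h *: 1.
Proof.
apply: S_inj; rewrite linear_klift; last by linear.
rewrite linearZ /= antipode1 -antipodel.
by apply: eq_klift => x y; rewrite antipodeM antipode_invK.
Qed.

Lemma antipode_invr h : \sw_(h1, h2 <- h) (h2 * Si h1) = counit h *: 1.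
Proof.
apply: S_inj; rewrite linear_klift; last by linear.
rewrite linearZ /= antipode1 -antipoder.
by apply: eq_klift => x y; rewrite antipodeM antipode_invK.
Qed.

Lemma sw_antipode_inv (V : lmodType k) (F : H -> H -> V) h :
  (forall y, linear (F^~ y)) -> (forall x, linear (F x)) ->
  \sw_(x, y <- Si h) F x y = \sw_(h1, h2 <- h) F (Si h2) (Si h1).
Proof.
move=> Fl Fr; rewrite -[in RHS](antipode_invK h) sw_antipode; try by linear.
by apply: eq_klift => x y; rewrite !antipodeK.
Qed.

Lemma exists_dual_integral :
  exists lam : {scalar H}, \sw_(t1, t2 <- t) (lam t2 *: t1) = 1.
Proof.
have [f ft1] := exists_scalar_one.
(* Expand t2 in f(t3) S^-1(t2) t1 = 1 and move S^-1(e_i) across the tensor. *)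
pose lam h := \sum_i \sw_(h1, h2 <- Si (Si e`_i) * h)
  (coord e i h1 *: (f h2 : k^o)).
have laml : linear (lam : H -> k^o) by rewrite /lam; linear.
exists (scalar_of laml).
transitivity (\sw_(a, b <- t) \sw_(b1, b2 <- b) (f b2 *: (Si b1 * a))).
  transitivity (\sum_i \sw_(a, b <- t) \sw_(b1, b2 <- b)
    (coord e i b1 *: (f b2 *: (Si e`_i * a)))).
    transitivity (\sum_i \sw_(a, b <- t) \sw_(b1, b2 <- Si (Si e`_i) * b)
      (coord e i b1 *: (f b2 *: a))).
      rewrite -klift_sum; apply: eq_klift => a b /=; rewrite /lam scaler_suml.
      apply: eq_bigr => i _.
      rewrite (linear_klift (f := fun c : k^o => (c : k) *: a)).
        by apply: eq_klift => b1 b2; rewrite scalerA.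
      by move=> c u v; rewrite scalerDl scalerA.
    apply: eq_bigr => i _.
    rewrite -(integral_shift (F := fun a b => \sw_(b1, b2 <- b)
      (coord e i b1 *: (f b2 *: a)))) ?antipode_invK //; linear.
  rewrite -klift_sum; apply: eq_klift => a b; rewrite -klift_sum.
  apply: eq_klift => b1 b2.
  rewrite (sum_coord (f := fun z => f b2 *: (Si z * a)) b1) //; linear.
rewrite -(sw_coassoc (F := fun a b1 b2 => f b2 *: (Si b1 * a))); try by linear.
transitivity (\sw_(a, b <- t) (f b *: (counit a *: (1 : H)))).
  by apply: eq_klift => a b; rewrite -scaler_klift antipode_invl.
rewrite -[RHS]scale1r -ft1 -(sw_counitl (f := fun z => f z *: (1 : H)));
  last by linear.
by apply: eq_klift => a b; rewrite !scalerA mulrC.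
Qed.

(** S^-1(u) is a right integral, so u = u t1 lam(t2) = t1 lam(S^-1(u) t2) = lam(S^-1(u)) t. Choosing
    [lam] before [u] makes the scalar linear in u. *)
Lemma integral_unique : exists lam : {scalar H},
  forall u, left_integral u -> u = lam (Si u) *: t.
Proof.
have [lam lamE] := exists_dual_integral; exists lam => u u_int.
have Siu h : Si u * h = counit h *: Si u.
  apply: S_inj; rewrite antipodeM antipode_invK u_int counit_antipode.
  by rewrite linearZ /= antipode_invK.
rewrite -[LHS]mulr1 -lamE mulr_klift.
transitivity (\sw_(t1, t2 <- t) (lam t2 *: (S (Si u) * t1))).
  by apply: eq_klift => a b; rewrite antipode_invK scalerAr.
rewrite (integral_shift (F := fun a b => lam b *: a)); try by linear.
rewrite -[in RHS](counitr t) scaler_klift; apply: eq_klift => a b.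
by rewrite Siu linearZ /= scalerA mulrC.
Qed.

Lemma scale_integral_inj (c d : k) : c *: t = d *: t -> c = d.
Proof.
move/eqP; rewrite -subr_eq0 -scalerBl scaler_eq0 (negPf t_neq0) orbF subr_eq0.
by move/eqP.
Qed.

(** t h is again a left integral, hence a multiple of t by a scalar linear in h. *)
Lemma modular_char_scalar :
  exists2 al : {scalar H}, modular_char t =1 al & forall h, t * h = al h *: t.
Proof.
have [lam lamE] := integral_unique.
have al_lin : linear (fun h => lam (Si (t * h)) : k^o).
  by move=> c u v; rewrite mulrDr -scalerAr !linearP.
have alE h : t * h = scalar_of al_lin h *: t.
  by apply: lamE => g; rewrite mulrA t_int -scalerAl.
exists (scalar_of al_lin) => // h; apply: scale_integral_inj.
(* Existence rules out the default 0 of [xget] in [modular_char]. *)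
have cE : exists c : k, t * h = c *: t by exists (scalar_of al_lin h).
by rewrite -[RHS]alE; symmetry; apply: (classical_sets.xgetPex 0 cE).
Qed.

(** * The modular character *)

Section Modular.
Variable al : {scalar H}.
Hypothesis alE : forall h, t * h = al h *: t.

Lemma modular1 : al 1 = 1.
Proof. by apply: scale_integral_inj; rewrite -alE mulr1 scale1r. Qed.

Lemma modularM : {morph al : h g / h * g}.
Proof.
move=> h g; apply: scale_integral_inj.
by rewrite -alE mulrA alE -scalerAl alE scalerA.
Qed.

(** Replacing alpha(h2) t by t h2 gives t1 h2 S^-1(h1) in the first slot and t2 h3 in the second,
    and h2 S^-1(h1) cancels. *)
Lemma integral_modular_shift (V : lmodType k) (F : H -> H -> V) h :
  (forall y, linear (F^~ y)) -> (forall x, linear (F x)) ->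
  \sw_(h1, h2 <- h) (al h2 *: \sw_(t1, t2 <- t) F (t1 * Si h1) t2) =
  \sw_(t1, t2 <- t) F t1 (t2 * h).
Proof.
move=> Fl Fr.
transitivity (\sw_(h1, h2 <- h) \sw_(a, b <- h2) \sw_(t1, t2 <- t)
  F (t1 * (a * Si h1)) (t2 * b)).
  apply: eq_klift => h1 h2.
  rewrite -(linear_scaleE (f := fun z => \sw_(x, y <- z) F (x * Si h1) y));
    last by linear.
  rewrite -alE sw_mul; try by linear.
  rewrite exchange_klift; apply: eq_klift => a b.
  by apply: eq_klift => t1 t2; rewrite mulrA.
rewrite -(sw_coassoc (F := fun h1 a b => \sw_(t1, t2 <- t)
  F (t1 * (a * Si h1)) (t2 * b))); try by linear.
rewrite (sw_cancell antipode_invr (F := fun z b => \sw_(t1, t2 <- t)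
  F (t1 * z) (t2 * b))); try by linear.
by apply: eq_klift => t1 t2; rewrite mulr1.
Qed.

(** Insert 1 = t1' lam(t2') before S^-1(t1), for a second copy t' of t. The modular shift turns the
    sum into t1' lam(t2' t), which is lam(t) t. *)
Lemma antipode_inv_integral : \sw_(t1, t2 <- t) (al t2 *: Si t1) = t.
Proof.
have [lam lamE] := exists_dual_integral.
(* Apply the counit to t1 lam(t2) = 1. *)
have lamt : lam t = 1.
  transitivity (counit (1 : H)); last exact: counit1.
  rewrite -lamE -[in LHS](counitl t).
  rewrite (raddf_klift _ _ (f := lam)) => [|u v]; last by rewrite linearD.
  rewrite (raddf_klift _ _ (f := counit)) => [|u v]; last by rewrite linearD.
  by apply: eq_klift => a b; rewrite !linearZ /= mulrC.
transitivity (\sw_(h1, h2 <- t)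
  (al h2 *: \sw_(t1, t2 <- t) (lam t2 *: (t1 * Si h1)))).
  apply: eq_klift => h1 h2; rewrite -[in LHS](mul1r (Si h1)) -lamE klift_mulr.
  by congr (_ *: _); apply: eq_klift => a b; rewrite scalerAl.
rewrite (integral_modular_shift (F := fun x y => lam y *: x)); try by linear.
rewrite -[RHS]scale1r -lamt -[in X in _ = _ *: X](counitr t) scaler_klift.
by apply: eq_klift => a b; rewrite t_int linearZ /= scalerA mulrC.
Qed.

End Modular.
End Integral.

Lemma linear_ktensor_ext (k : fieldType) (M N V : lmodType k)
    (f g : (M \ox N)%type -> V) :
  linear f -> linear g -> (forall m n, f (m \ox n) = g (m \ox n)) -> f =1 g.
Proof. by move=> fl gl; apply: ktensor_ext; apply: linear_addE. Qed.

(** * The left action of the smash product and the partial invariants *)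

Section PartialAction.
Variables (k : fieldType) (H : hopfType k) (A : algType k).
Variable pa : partial_action H A.

(** Defined on all of A \ox H, so that identities can be checked on pure tensors, which need not lie
    in [smash]. *)
Definition lact (x : (A \ox H)%type) (b : A) : A :=
  klift (fun a h => a * pa h b) x.

Lemma lact_linearl b : linear (lact^~ b).
Proof. by rewrite /lact; linear. Qed.

Lemma lact_linearr x : linear (lact x).
Proof. by rewrite /lact; linear. Qed.

Lemma lact_tens a h b : lact (a \ox h) b = a * pa h b.
Proof. by rewrite /lact klift_tens //; apply: bilinear_kbalanced; linear. Qed.

Lemma lact_mul x y b : lact (smash_mul pa x y) b = lact x (lact y b).
Proof.
have ll := lact_linearl; have lr := lact_linearr.
have sl := smash_mull pa; have sr := smash_mulr pa.
move: x; apply: linear_ktensor_ext; try by linear.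
move=> a h; move: y; apply: linear_ktensor_ext; try by linear.
move=> c g; rewrite smash_mulE !lact_tens pact_mul_comp mulr_klift.
rewrite (linear_klift _ _ (ll b)); apply: eq_klift => h1 h2.
by rewrite lact_tens mulrA.
Qed.

Lemma lact_smash_elt a h b : lact (smash_elt pa a h) b = a * pa h b.
Proof.
rewrite /= (linear_klift _ _ (lact_linearl b)) -[in RHS](mul1r b) pactM.
rewrite mulr_klift; apply: eq_klift => h1 h2.
by rewrite lact_tens mulrA.
Qed.

Lemma pact_invl h c a : c \in pinv pa -> pa h (c * a) = c * pa h a.
Proof.
move=> /pinvP cI; rewrite -[in RHS](mul1r a) !pactM mulr_klift.
by apply: eq_klift => x y; rewrite cI mulrA.
Qed.

Section Central.
Hypothesis pa_central : forall (h : H) (a : A), pa h 1 * a = a * pa h 1.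

Lemma pact_invr h c a : c \in pinv pa -> pa h (a * c) = pa h a * c.
Proof.
move=> /pinvP cI; rewrite -[in RHS](mulr1 a) !pactM klift_mulr.
by apply: eq_klift => x y; rewrite cI -pa_central mulrA.
Qed.

(** In h.(t.a) = (h1.1)(h2 t.a) the integral absorbs h2; centrality then moves h.1 to the right. *)
Lemma pact_integral_inv t a : left_integral t -> pa t a \in pinv pa.
Proof.
move=> t_int; apply/pinvP => h; rewrite pact_comp -pa_central.
rewrite -(sw_counitr (f := fun h => pa h 1 * pa t a)); last by linear.
by apply: eq_klift => x y; rewrite t_int linearZl_LR /= -scalerAr.
Qed.

End Central.

Section Symmetric.
Hypothesis pa_sym : symmetric_action pa.

(** Symmetry leaves a factor h2.1, absorbed through (h2.1)(h3.b) = h2.b. *)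
Lemma pact_comp_mul h g a b :
  pa h (pa g a * b) = \sw_(h1, h2 <- h) (pa (h1 * g) a * pa h2 b).
Proof.
rewrite pactM.
transitivity (\sw_(h1, h2 <- h) \sw_(x, y <- h1)
  (pa (x * g) a * (pa y 1 * pa h2 b))).
  apply: eq_klift => h1 h2; rewrite pa_sym klift_mulr.
  by apply: eq_klift => x y; rewrite mulrA.
rewrite sw_coassoc; try by linear.
by apply: eq_klift => x y; rewrite -mulr_klift -pactM mul1r.
Qed.

End Symmetric.

(** * The right action and the two pairings *)

Section Integral.
Variables (t : H) (al : {scalar H}).
Hypotheses (t_neq0 : t != 0) (t_int : left_integral t).
Hypothesis alE : forall h, t * h = al h *: t.
Notation Si := (@antipode_inv k H).

(** Uses a scalar form [al], whose linearity is part of its type; [theorem1] supplies the one equal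
    to [modular_char]. *)
Definition ract (b : A) (x : (A \ox H)%type) : A :=
  klift (fun a h => \sw_(h1, h2 <- h) (al h2 *: pa (Si h1) (b * a))) x.

Lemma ract_linearl x : linear (ract^~ x).
Proof. by rewrite /ract; linear. Qed.

Lemma ract_linearr b : linear (ract b).
Proof. by rewrite /ract; linear. Qed.

Lemma ract_tens a h b :
  ract b (a \ox h) = \sw_(h1, h2 <- h) (al h2 *: pa (Si h1) (b * a)).
Proof. by rewrite /ract klift_tens //; apply: bilinear_kbalanced; linear. Qed.

(** Splitting the action over a (h1.b) puts S^-1(h2) h1 in front of b, where it cancels. Thus S^-1
    removes a factor h1.b that the smash product has created. *)
Lemma sw_pact_antipode_inv g h a b :
  \sw_(h1, h2 <- h) pa (g * Si h2) (a * pa h1 b) =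
  \sw_(g1, g2 <- g) (pa (g1 * Si h) a * pa g2 b).
Proof.
transitivity (\sw_(h1, h2 <- h) \sw_(x, y <- h2) \sw_(g1, g2 <- g)
  (pa (g1 * Si y) a * pa (g2 * (Si x * h1)) b)).
  apply: eq_klift => h1 h2.
  rewrite pact_mul_comp sw_mul; try by linear.
  rewrite [RHS]exchange_klift; apply: eq_klift => g1 g2.
  rewrite (sw_antipode_inv t_neq0 t_int); try by linear.
  by apply: eq_klift => x y; rewrite mulrA.
rewrite -(sw_coassoc (F := fun h1 x y => \sw_(g1, g2 <- g)
  (pa (g1 * Si y) a * pa (g2 * (Si x * h1)) b))); try by linear.
rewrite (sw_cancell (antipode_invl t_neq0 t_int) (F := fun z y =>
  \sw_(g1, g2 <- g) (pa (g1 * Si y) a * pa (g2 * z) b))); try by linear.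
by apply: eq_klift => x y; rewrite mulr1.
Qed.

Lemma ract_smash_elt b a h : ract b (smash_elt pa a h) =
  \sw_(h1, h2 <- h) (al h2 *: pa (Si h1) (b * a)).
Proof.
rewrite /= (linear_klift _ _ (ract_linearr b)).
transitivity (\sw_(h1, h2 <- h) \sw_(x, y <- h2)
  (al y *: pa (Si x) (b * a * pa h1 1))).
  apply: eq_klift => h1 h2; rewrite ract_tens.
  by apply: eq_klift => x y; rewrite mulrA.
rewrite -(sw_coassoc (F := fun h1 x y => al y *: pa (Si x) (b * a * pa h1 1)));
  try by linear.
apply: eq_klift => u y; rewrite -scaler_klift; congr (_ *: _).
transitivity (\sw_(h1, x <- u) pa (1 * Si x) (b * a * pa h1 1)).
  by apply: eq_klift => h1 x; rewrite mul1r.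
rewrite sw_pact_antipode_inv sw_1; try by linear.
by rewrite mul1r pact1 mulr1.
Qed.

Lemma ract1 b : ract b (1 \ox 1) = b.
Proof.
rewrite ract_tens sw_1; try by linear.
rewrite (modular1 t_neq0 alE) scale1r (antipode_inv1 t_neq0 t_int).
by rewrite pact1 mulr1.
Qed.

Lemma ract_invl c b x : c \in pinv pa -> ract (c * b) x = c * ract b x.
Proof.
move=> cI; rewrite /ract mulr_klift; apply: eq_klift => a h.
rewrite mulr_klift; apply: eq_klift => h1 h2.
by rewrite -mulrA pact_invl // scalerAr.
Qed.

(** S^-1 reverses products and alpha is multiplicative. [sw_pact_antipode_inv] removes h1 from c,
    and [pact_comp_mul], hence symmetry, reassembles the nested action. *)
Lemma ract_mul b x y : symmetric_action pa ->
  ract b (smash_mul pa x y) = ract (ract b x) y.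
Proof.
move=> pa_sym.
have rl := ract_linearl; have rr := ract_linearr.
have sl := smash_mull pa; have sr := smash_mulr pa.
move: x; apply: linear_ktensor_ext; try by linear.
move=> a h; move: y; apply: linear_ktensor_ext; try by linear.
move=> c g; rewrite smash_mulE !ract_tens (linear_klift _ _ (rr b)).
transitivity (\sw_(h1, h2 <- h) \sw_(x, y <- h2) \sw_(z, w <- g)
  (al y *: (al w *: pa (Si z * Si x) (b * a * pa h1 c)))).
  apply: eq_klift => h1 h2; rewrite ract_tens sw_mul; try by linear.
  apply: eq_klift => x y; apply: eq_klift => z w.
  by rewrite (modularM t_neq0 alE) (antipode_invM t_neq0 t_int) scalerA mulrA.
rewrite -(sw_coassoc (F := fun h1 x y => \sw_(z, w <- g)
  (al y *: (al w *: pa (Si z * Si x) (b * a * pa h1 c))))); try by linear.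
transitivity (\sw_(u, y <- h) \sw_(z, w <- g)
   (al y *: (al w *: pa (Si z) (pa (Si u) (b * a) * c)))).
  apply: eq_klift => u y; rewrite exchange_klift; apply: eq_klift => z w.
  by rewrite -!scaler_klift sw_pact_antipode_inv pact_comp_mul.
rewrite exchange_klift; apply: eq_klift => z w; rewrite klift_mulr.
rewrite (linear_klift (f := fun v => al w *: pa (Si z) v)); last by linear.
apply: eq_klift => u y.
by rewrite -scalerAl linearZr_LR /= !scalerA mulrC.
Qed.

(** The pairing [a,b] inside A \ox H, by [smash_elt_sandwich]. *)
Definition sandwich (a b : A) : (A \ox H)%type :=
  \sw_(t1, t2 <- t) ((a * pa t1 b) \ox t2).

Lemma sandwichE a b : sandwich a b = smash_mul pa (a \ox t) (b \ox 1).
Proof. by rewrite smash_mulE; apply: eq_klift => x y; rewrite mulr1. Qed.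

Lemma sandwich_linearl b : linear (sandwich^~ b).
Proof. by rewrite /sandwich; linear. Qed.

Lemma sandwich_linearr a : linear (sandwich a).
Proof. by rewrite /sandwich; linear. Qed.

Lemma smash_elt_val1 a : smash_elt pa a 1 = a \ox 1 :> (A \ox H)%type.
Proof.
rewrite /= sw_1; try by linear.
by rewrite pact1 mulr1.
Qed.

Lemma smash_elt_valE a h :
  smash_elt pa a h = smash_mul pa (a \ox h) (1 \ox 1) :> (A \ox H)%type.
Proof. by rewrite smash_mulE; apply: eq_klift => x y; rewrite mulr1. Qed.

Lemma smash_valM (x y : smash pa) : smash_val (x * y) = smash_mul pa x y.
Proof. by []. Qed.

Lemma smash_mul1l a b h : smash_mul pa (a \ox 1) (b \ox h) = (a * b) \ox h.
Proof.
rewrite smash_mulE sw_1; try by linear.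
by rewrite pact1 mul1r.
Qed.

Lemma smash_elt_sandwich a b :
  smash_elt pa a 1 * smash_elt pa 1 t * smash_elt pa b 1 = sandwich a b
    :> (A \ox H)%type.
Proof.
rewrite !smash_valM !smash_elt_val1 smash_elt_valE sandwichE.
by rewrite !smash_mulA smash_mul1l mulr1 -smash_mulA smash_mul1x.
Qed.

(** In (c \ox h)(a \ox t) the integral absorbs h2, leaving c (h.a) \ox t. *)
Lemma sandwich_lact x a b :
  smash_mul pa x (sandwich a b) = sandwich (lact x a) b.
Proof.
have ll := lact_linearl; have ql := sandwich_linearl; have sl := smash_mull pa.
move: x; apply: linear_ktensor_ext; try by linear.
move=> c h; rewrite lact_tens !sandwichE smash_mulA; congr smash_mul.
rewrite smash_mulE -(sw_counitr (f := fun h => (c * pa h a) \ox t));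
  last by linear.
by apply: eq_klift => x y; rewrite t_int ktensZr.
Qed.

(* Fails without the factor [1 \ox 1], a source of the h_(2).1 of symmetry. *)
Lemma sandwich_ract x a b : symmetric_action pa ->
  smash_mul pa (sandwich a b) (smash_mul pa x (1 \ox 1)) =
  sandwich a (ract b x).
Proof.
move=> pa_sym.
have rr := ract_linearr; have qr := sandwich_linearr.
have sl := smash_mull pa; have sr := smash_mulr pa.
move: x; apply: linear_ktensor_ext; try by linear.
move=> c h; rewrite ract_tens.
transitivity (\sw_(t1, t2 <- t) \sw_(x, y <- t2 * h)
   ((a * pa t1 (b * c) * pa x 1) \ox y)).
  rewrite sandwichE -smash_mulA [smash_mul _ (b \ox 1) _]smash_mulA smash_mul1l.
  rewrite smash_mulA smash_mulE (linear_klift _ _ (sl (1 \ox 1))).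
  apply: eq_klift => t1 t2; rewrite smash_mulE.
  by apply: eq_klift => x y; rewrite mulr1.
(* The shift trades right multiplication of t2 by h for alpha(h2) and S^-1(h1), as they occur in
   [ract]. *)
rewrite -(integral_modular_shift t_neq0 t_int alE (F := fun x z =>
  \sw_(z1, z2 <- z) ((a * pa x (b * c) * pa z1 1) \ox z2))); try by linear.
rewrite (linear_klift _ _ (qr a)); apply: eq_klift => h1 h2.
rewrite (linear_scaleE _ _ (qr a)); congr (_ *: _).
rewrite /sandwich -(sw_coassoc (F := fun x y z =>
  (a * pa (x * Si h1) (b * c) * pa y 1) \ox z)); try by linear.
apply: eq_klift => x y; rewrite pa_sym mulr_klift.
rewrite (linear_klift (f := fun u => u \ox y)); last by linear.
by apply: eq_klift => u v; rewrite mulrA.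
Qed.

Lemma lact_sandwich a b c : lact (sandwich a b) c = a * pa t (b * c).
Proof.
rewrite /sandwich (linear_klift _ _ (lact_linearl c)) pactM mulr_klift.
by apply: eq_klift => x y; rewrite lact_tens mulrA.
Qed.

(** Acting by b \ox t applies alpha(t2) S^-1(t1) = t to ab; acting by c \ox 1 then multiplies by
    c. *)
Lemma ract_sandwich a b c : symmetric_action pa ->
  ract a (sandwich b c) = pa t (a * b) * c.
Proof.
move=> pa_sym; rewrite sandwichE ract_mul // ract_tens.
transitivity (ract (pa t (a * b)) (c \ox 1)).
  congr ract; rewrite -[in RHS](antipode_inv_integral t_neq0 t_int alE).
  rewrite (linear_klift (f := fun h => pa h (a * b))); last by linear.
  by apply: eq_klift => x y; rewrite linearZl_LR.
rewrite ract_tens sw_1; try by linear.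
by rewrite (modular1 t_neq0 alE) scale1r (antipode_inv1 t_neq0 t_int) pact1.
Qed.

(** For x = c \ox h, the right side is (t1.(ac))(t2 h.b). The modular shift removes h from the
    second factor, and [pact_comp_mul] collects the result. *)
Lemma pact_integral_balanced a x b : symmetric_action pa ->
  pa t (ract a x * b) = pa t (a * lact x b).
Proof.
move=> pa_sym; have rr := ract_linearr; have ll := lact_linearl.
move: x; apply: linear_ktensor_ext; try by linear.
move=> c h; rewrite ract_tens lact_tens mulrA pact_mul_comp.
rewrite -(integral_modular_shift t_neq0 t_int alE
  (F := fun x y => pa x (a * c) * pa y b)); try by linear.
rewrite klift_mulr (linear_klift (f := pa t)); last by linear.
apply: eq_klift => h1 h2.
by rewrite -scalerAl linearZr_LR /= pact_comp_mul.
Qed.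

End Integral.
End PartialAction.

(** * Assembling the Morita context from identities on pure tensors *)

Lemma tlift_bimodule_morphism (R S : pzRingType) (M N : zmodType)
    (lM : R -> M -> M) (rM : M -> S -> M) (lN : S -> N -> N) (rN : N -> R -> N)
    (F : M -> N -> R) :
  bimodule lM rM -> bimodule lN rN -> balanced rM lN F ->
  (forall r m n, F (lM r m) n = r * F m n) ->
  (forall m n r, F m (rN n r) = F m n * r) ->
  bimodule_morphism (tensor_lact lM rM lN) (tensor_ract rM lN rN) *%R *%R
    (tlift F : tensor rM lN -> R).
Proof.
move=> bM bN Fb Fl Fr.
have lb r : balanced rM lN (fun m n => tens rM lN (lM r m) n).
  split=> [n m m'|m n n'|m s n].
  - by rewrite (lactDr (bimod_left bM)) tensDl.
  - by rewrite tensDr.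
  - by rewrite -(bimodA bM) tens_balanced.
have rb r : balanced rM lN (fun m n => tens rM lN m (rN n r)).
  split=> [n m m'|m n n'|m s n].
  - by rewrite tensDl.
  - by rewrite (ractDl (bimod_right bN)) tensDr.
  - by rewrite (bimodA bN) tens_balanced.
split; first exact: tliftD.
  move=> r; apply: tensor_ext => [x y|x y|m n].
  - by rewrite /tensor_lact !tliftD.
  - by rewrite tliftD // mulrDr.
  - by rewrite /tensor_lact !tlift_tens.
move=> x r; move: x; apply: tensor_ext => [x y|x y|m n].
- by rewrite /tensor_ract !tliftD.
- by rewrite tliftD // mulrDl.
- by rewrite /tensor_ract !tlift_tens.
Qed.

Theorem theorem1 (k : fieldType) (H : hopfType k) (t : H) (A : algType k)
    (pa : partial_action H A)
    (t_neq0 : t != 0) (t_int : left_integral t)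
    (pa_sym : symmetric_action pa)
    (pa_central : forall (h : H) (a : A), pa h 1 * a = a * pa h 1) :
  exists (lsm : smash pa -> A -> A) (rsm : A -> smash pa -> A)
         (sq : tensor (pinv_ract pa) (pinv_lact pa) -> smash pa)
         (ang : tensor rsm lsm -> pinvariants pa),
  [/\ forall (a : A) (h : H) (b : A), lsm (smash_elt pa a h) b = a * pa h b,
      forall (b a : A) (h : H), rsm b (smash_elt pa a h) =
        \sw_(h1, h2 <- h) (modular_char t h2 *: pa (antipode_inv h1) (b * a)),
      forall a b : A, sq (tens _ _ a b) =
        smash_elt pa a 1 * smash_elt pa 1 t * smash_elt pa b 1,
      forall a b : A, pinv_val (ang (tens _ _ a b)) = pa t (a * b)
    & morita_context lsm (pinv_ract pa) (pinv_lact pa) rsm sq ang].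
Proof.
have [al al_modular alE] := modular_char_scalar t_neq0 t_int.
pose lsm (x : smash pa) (b : A) := lact pa x b.
pose rsm (b : A) (x : smash pa) := ract pa al b x.
pose sq (a b : A) := smash_elt pa a 1 * smash_elt pa 1 t * smash_elt pa b 1.
have sqE a b : smash_val (sq a b) = sandwich pa t a b.
  exact: smash_elt_sandwich.
pose ang (a b : A) := PInvariant (pact_integral_inv pa_central (a * b) t_int).
have sval_inj : injective (@smash_val _ _ _ pa) by apply: val_inj.
have svalD (x y : smash pa) : smash_val (x + y) = smash_val x + smash_val y.
  by [].
have ll b := linear_addE (lact_linearl pa b).
have lr x := linear_addE (lact_linearr pa x).
have rl x := linear_addE (ract_linearl pa al x).
have rr b := linear_addE (ract_linearr pa al b).
have bimodM : bimodule lsm (pinv_ract pa).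
  split; [split|split|].
  - by move=> b x y; apply: ll.
  - by move=> x; apply: lr.
  - by move=> b; rewrite /lsm /= lact_tens pact1 mul1r.
  - by move=> x y b; apply: lact_mul.
  - by move=> c a b; apply: mulrDl.
  - by move=> a b c; apply: mulrDr.
  - by move=> a; apply: mulr1.
  - by move=> a b c; apply: mulrA.
  - move=> x a c; rewrite /lsm /lact /pinv_ract klift_mulr.
    apply: eq_klift => b h.
    by rewrite pact_invr ?mulrA //; apply: valP.
have bimodN : bimodule (pinv_lact pa) rsm.
  split; [split|split|].
  - by move=> b c c'; apply: mulrDl.
  - by move=> c a b; apply: mulrDr.
  - by move=> a; apply: mul1r.
  - by move=> c c' b; rewrite /pinv_lact mulrA.
  - by move=> x a b; apply: rl.
  - by move=> a x y; apply: rr.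
  - by move=> b; apply: ract1 t_neq0 t_int alE _.
  - by move=> b x y; apply: ract_mul t_neq0 t_int alE _ _ _ pa_sym.
  - by move=> c b x; apply: ract_invl; apply: valP.
have sqb : balanced (pinv_ract pa) (pinv_lact pa) sq.
  split=> [b a a'|a b b'|a c b]; apply: sval_inj; rewrite ?svalD !sqE.
  - exact: linear_addE (sandwich_linearl _ _ _) _ _.
  - exact: linear_addE (sandwich_linearr _ _ _) _ _.
  - apply: eq_klift => x y; rewrite pact_invl ?mulrA //; exact: valP.
have angb : balanced rsm lsm ang.
  split=> [b a a'|a b b'|a x b]; apply: val_inj; rewrite /= ?raddfD /=.
  - by rewrite mulrDl linearDr.
  - by rewrite mulrDr linearDr.
  - exact: pact_integral_balanced.
exists lsm, rsm, (tlift sq), (tlift ang); split.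
- by move=> a h b; apply: lact_smash_elt.
- move=> b a h; rewrite /rsm (ract_smash_elt _ _ t_neq0 t_int).
  by apply: eq_klift => x y; rewrite al_modular.
- by move=> a b; rewrite tlift_tens.
- by move=> a b; rewrite tlift_tens.
split=> //.
- apply: tlift_bimodule_morphism => // [x a b|a b x]; apply: sval_inj.
    by rewrite sqE smash_valM sqE sandwich_lact.
  (* An element x of [smash] equals x (1 \ox 1), the form that [sandwich_ract] requires. *)
  rewrite sqE smash_valM sqE -(sandwich_ract t_neq0 t_int alE) //.
  by rewrite smash_mulx1 //; apply: valP.
- apply: tlift_bimodule_morphism => // [c a b|a b c]; apply: val_inj => /=.
    by rewrite /pinv_lact -mulrA pact_invl //; apply: valP.
  by rewrite /pinv_ract mulrA pact_invr //; apply: valP.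
- by move=> a b c; rewrite !tlift_tens // /lsm sqE lact_sandwich.
- move=> a b c; rewrite !tlift_tens // /rsm sqE.
  by rewrite (ract_sandwich t_neq0 t_int alE).
Qed.
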